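(* Let $\mathfrak{e}$ be an injective endomorphism of the semigroup $\boldsymbol{B}_{\mathbb{Z}}^{\mathscr{F}^2}$ such that $(0,0,[0))\mathfrak{e}=(0,0,[0))$. Then one of the following conditions holds: (1) there exist a positive integer $k$ and $p\in\{0,\ldots,k-1\}$ such that $\mathfrak{e}=\alpha_{k,p}$; (2) there exist a positive integer $k\geqslant 2$ and $p\in\{1,\ldots,k-1\}$ such that $\mathfrak{e}=\beta_{k,p}$.
   Context: Let $\omega$ be the set of non-negative integers, and $[a)=\{x\in\omega\colon x\geqslant a\}$ for $a\in\omega$. A subset $A\subseteq\omega$ is inductive if $i\in A$ implies $i+1\in A$. For an integer $m$ and $F\subseteq\omega$ put $m+F=\{m+x\colon x\in F\}\subseteq\mathbb{Z}$. A family $\mathscr{F}$ of subsets of $\omega$ is $\omega$-closed if $F_1\cap(-n+F_2)\in\mathscr{F}$ for all $n\in\omega$ and $F_1,F_2\in\mathscr{F}$. Throughout, $\mathscr{F}^2$ is an $\omega$-closed family consisting of exactly two inductive nonempty subsets of $\omega$ with $[0)\in\mathscr{F}^2$; equivalently, $\mathscr{F}^2=\{[0),[1)\}$. The semigroup $\boldsymbol{B}_{\mathbb{Z}}^{\mathscr{F}^2}$ is the set $\mathbb{Z}\times\mathbb{Z}\times\mathscr{F}^2$ with the operation $$(i_1,j_1,F_1)\cdot(i_2,j_2,F_2)=\begin{cases}(i_1-j_1+i_2,\,j_2,\,(j_1-i_2+F_1)\cap F_2), & j_1\leqslant i_2;\\ (i_1,\,j_1-i_2+j_2,\,F_1\cap(i_2-j_1+F_2)),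 & j_1\geqslant i_2.\end{cases}$$ Maps are written on the right of their arguments. For a positive integer $k$ and $p\in\{0,\ldots,k-1\}$, $\alpha_{k,p}$ is the self-map of $\boldsymbol{B}_{\mathbb{Z}}^{\mathscr{F}^2}$ given, for all $i,j\in\mathbb{Z}$, by $(i,j,[0))\alpha_{k,p}=(ki,kj,[0))$ and $(i,j,[1))\alpha_{k,p}=(p+ki,p+kj,[1))$. For a positive integer $k\geqslant2$ and $p\in\{1,\ldots,k-1\}$, $\beta_{k,p}$ is the self-map given, for all $i,j\in\mathbb{Z}$, by $(i,j,[0))\beta_{k,p}=(ki,kj,[0))$ and $(i,j,[1))\beta_{k,p}=(p+ki,p+kj,[0))$. *)

(* Defs.v *)
From HB Require Import structures.
From mathcomp Require Import all_boot all_order all_algebra zify.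
From mathcomp Require Import boolp classical_sets functions cardinality.

Set Implicit Arguments.
Unset Strict Implicit.
Unset Printing Implicit Defensive.

Import Order.TTheory GRing.Theory Num.Theory.

Local Open Scope classical_set_scope.
Local Open Scope ring_scope.
Local Open Scope card_scope.

Definition up (a : nat) : set nat := [set x | (a <= x)%N].

Definition inductive_set (A : set nat) : Prop := forall i, A i -> A i.+1.

Definition shift (m : int) (A : set nat) : set int :=
  [set m + x%:Z | x in A].

(* For [A : set nat] and [S : set int], the intersection of [A] and [S] is a
   subset of [nat]; it is written with the trace of [S] on [nat]. *)
Definition trace (S : set int) : set nat := [set x | S x%:Z].

Definition omega_closed (F : set (set nat)) : Prop :=
  forall (n : nat) (A B : set nat),
    F A -> F B -> F (A `&` trace (shift (- n%:Z) B)).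

(* The two cases agree when j1 = i2, see [raw_mul_ge]. *)
Definition raw_mul (x y : int * int * set nat) : int * int * set nat :=
  let: (i1, j1, A) := x in
  let: (i2, j2, B) := y in
  if j1 <= i2
  then (i1 - j1 + i2, j2, trace (shift (j1 - i2) A) `&` B)
  else (i1, j1 - i2 + j2, A `&` trace (shift (i2 - j1) B)).

Lemma shift0 (A : set nat) : trace (shift 0 A) = A.
Proof.
apply/seteqP; split => x /=; last by move=> Ax; exists x; rewrite ?add0r.
by move=> [y Ay]; rewrite add0r => -[<-].
Qed.

Lemma raw_mul_ge (i1 j1 i2 j2 : int) (A B : set nat) : i2 <= j1 ->
  raw_mul (i1, j1, A) (i2, j2, B) =
  (i1, j1 - i2 + j2, A `&` trace (shift (i2 - j1) B)).
Proof.
move=> le_ij /=; case: ifP => // le_ji.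
have -> : i2 = j1 by apply/eqP; rewrite eq_le le_ij.
by rewrite !subrr !shift0 add0r subrK.
Qed.

Lemma traceN (n : nat) (A : set nat) (x : nat) :
  trace (shift (- n%:Z) A) x <-> A (x + n)%N.
Proof.
split=> [[y Ay] E|Ax]; last by exists (x + n)%N => //; lia.
have -> : (x + n = y)%N by lia.
exact: Ay.
Qed.

Lemma raw_mul_closed (F : set (set nat)) (clF : omega_closed F)
    (x y : int * int * set nat) :
  F x.2 -> F y.2 -> F (raw_mul x y).2.
Proof.
case: x => [[i1 j1] A]; case: y => [[i2 j2] B] /= FA FB.
case: ifP => /= le_ji.
  have -> : j1 - i2 = - (`|i2 - j1|%N)%:Z by lia.
  by rewrite setIC; apply: clF.
have -> : i2 - j1 = - (`|j1 - i2|%N)%:Z by lia.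
exact: clF.
Qed.

Lemma raw_mulE (i1 j1 i2 j2 : int) (A B : set nat) :
  raw_mul (i1, j1, A) (i2, j2, B) =
  (i1 + `|Num.max j1 i2 - j1|%N%:Z, j2 + `|Num.max j1 i2 - i2|%N%:Z,
   [set x | A (x + `|Num.max j1 i2 - j1|)%N /\
            B (x + `|Num.max j1 i2 - i2|)%N]).
Proof.
rewrite /=; case: ifP => le_ji.
  have -> : Num.max j1 i2 = i2 by lia.
  congr (_, _, _); [lia | lia |].
  have -> : j1 - i2 = - (`|i2 - j1|%N)%:Z by lia.
  by apply/seteqP; split=> x [/traceN Ax Bx]; split;
    rewrite ?subrr ?addn0 in Bx *; first [exact: Ax | exact: Bx | exact/traceN].
have -> : Num.max j1 i2 = j1 by lia.
congr (_, _, _); [lia | lia |].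
have -> : i2 - j1 = - (`|j1 - i2|%N)%:Z by lia.
by apply/seteqP; split=> x [Ax /traceN Bx]; split;
  rewrite ?subrr ?addn0 in Ax *; first [exact: Ax | exact: Bx | exact/traceN].
Qed.

Lemma raw_mulA : associative raw_mul.
Proof.
move=> [[i1 j1] A] [[i2 j2] B] [[i3 j3] C].
rewrite [raw_mul (i1, _, _) (i2, _, _)]raw_mulE.
rewrite [raw_mul (i2, _, _) (i3, _, _)]raw_mulE !raw_mulE.
congr (_, _, _); [lia | lia |].
have eqn (P : set nat) (m n : nat) : m = n -> P m -> P n by move=> ->.
apply/seteqP; split=> x /=.
  by move=> [h1 [h2 h3]]; split; [split|];
    [apply: eqn h1 | apply: eqn h2 | apply: eqn h3]; lia.
by move=> [[h1 h2] h3]; split; [|split];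
  [apply: eqn h1 | apply: eqn h2 | apply: eqn h3]; lia.
Qed.

(* [F] is coerced to the type of its members. *)
Definition BZ (F : set (set nat)) (_ : omega_closed F) : Type :=
  (int * int * F)%type.

HB.instance Definition _ (F : set (set nat)) (clF : omega_closed F) :=
  Choice.on (BZ clF).

Definition raw (F : set (set nat)) (clF : omega_closed F) (x : BZ clF) :
    int * int * set nat :=
  (x.1, val x.2).

Lemma raw_inj (F : set (set nat)) (clF : omega_closed F) :
  injective (@raw F clF).
Proof. by move=> [a A] [b B] [-> /val_inj ->]. Qed.

Lemma raw_mul_mem (F : set (set nat)) (clF : omega_closed F) (x y : BZ clF) :
  (raw_mul (raw x) (raw y)).2 \in F.
Proof. by apply/mem_set/(raw_mul_closed clF); apply/set_mem/valP. Qed.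

Definition bz_mul (F : set (set nat)) (clF : omega_closed F)
    (x y : BZ clF) : BZ clF :=
  ((raw_mul (raw x) (raw y)).1, exist (fun A => A \in F) _ (raw_mul_mem x y)).

Lemma raw_bz_mul (F : set (set nat)) (clF : omega_closed F) (x y : BZ clF) :
  raw (bz_mul x y) = raw_mul (raw x) (raw y).
Proof. exact: (esym (surjective_pairing _)). Qed.

Lemma bz_mulA (F : set (set nat)) (clF : omega_closed F) :
  associative (@bz_mul F clF).
Proof. by move=> x y z; apply: raw_inj; rewrite !raw_bz_mul raw_mulA. Qed.

HB.instance Definition _ (F : set (set nat)) (clF : omega_closed F) :=
  isSemigroup.Build (BZ clF) (@bz_mulA F clF).

Definition two_inductive (F : set (set nat)) : Prop :=
  [/\ F #= `I_2,
      forall A, F A -> inductive_set A /\ A !=set0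
    & F (up 0)].

Lemma inductive_up (A : set nat) :
  inductive_set A -> A !=set0 -> exists a, A = up a.
Proof.
move=> indA [x0 Ax0].
have exA : exists x, `[< A x >] by exists x0; apply/asboolP.
case: (ex_minnP exA) => a /asboolP Aa mina; exists a.
apply/seteqP; split=> x /= => [Ax|]; first by apply: mina; apply/asboolP.
rewrite /up /= => /subnKC <-; elim: (x - a)%N => [|n IHn].
  by rewrite addn0.
by rewrite addnS; apply: indA.
Qed.

Lemma up_inj : injective up.
Proof.
move=> a b E; apply/eqP; rewrite eqn_leq.
have : up b a by rewrite -E /up /=.
have : up a b by rewrite E /up /=.
by rewrite /up /= => -> ->.
Qed.

Lemma two_inductiveE (F : set (set nat)) :
  omega_closed F -> two_inductive F -> F = [set up 0; up 1].
Proof.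
move=> clF; case=> cardF indF F0.
have [f [homf injf surjf]] : exists f, set_bij `I_2 F f.
  by apply/card_set_bijP; rewrite card_eq_sym.
have F_eq A B : F A -> F B -> A <> up 0 -> B <> up 0 -> A = B.
  move=> /surjf[m m2 <-] /surjf[n n2 <-]; case: (surjf _ F0) => k k2 <-.
  move=> mk nk; congr f.
  have {}mk : m != k by apply/eqP => E; apply: mk; rewrite E.
  have {}nk : n != k by apply/eqP => E; apply: nk; rewrite E.
  by move: m2 n2 k2; rewrite /mkset => *; lia.
have [A FA nA] : exists2 A, F A & A <> up 0.
  have f01 : f 0%N <> f 1%N by move/injf; rewrite !inE /= => /(_ isT isT).
  have [E|nE] := pselect (f 0%N = up 0).
    by exists (f 1%N); [exact: homf | rewrite -E => /esym].
  by exists (f 0%N) => //; exact: homf.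
have [a Aa] : exists a, A = up a.
  by have [? ?] := indF _ FA; exact: inductive_up.
have a0 : (0 < a)%N by rewrite lt0n; apply/eqP => E; apply: nA; rewrite Aa E.
have F1 : F (up 1).
  have := clF a.-1 _ _ F0 FA; congr (F _); apply/seteqP; split=> x.
    by move=> [_ /traceN]; rewrite Aa /up /=; lia.
  by rewrite /up /= => x1; split=> //; apply/traceN; rewrite Aa /up /=; lia.
apply/seteqP; split=> B /=; last by case=> ->.
move=> FB; have [->|nB] := pselect (B = up 0); [by left | right].
by apply: F_eq => // /up_inj.
Qed.

Lemma two_inductive_up : two_inductive [set up 0; up 1].
Proof.
split; last by left.
- rewrite card_eq_sym; apply/card_set_bijP; exists up; split.
  + by move=> [|[|n]] //= _; [left | right].
  + by move=> m n _ _ /up_inj.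
  + by move=> A [] ->; [exists 0%N | exists 1%N].
- by move=> A [] ->; (split; last by exists 1%N) => i; rewrite /up /=; lia.
Qed.

Lemma omega_closed_up : omega_closed [set up 0; up 1].
Proof.
have trup n a b :
    up a `&` trace (shift (- n%:Z) (up b)) = up (maxn a (b - n)).
  apply/seteqP; split=> x; rewrite /up /=.
    by move=> [xa /traceN] /=; lia.
  by move=> xab; split; [|apply/traceN => /=]; lia.
move=> n A B [] -> [] ->; rewrite trup.
- by left; congr up; lia.
- by case: n => [|n]; [right | left]; congr up; lia.
- by right; congr up; lia.
- by right; congr up; lia.
Qed.

Lemma two_inductive0 (F : set (set nat)) : two_inductive F -> up 0 \in F.
Proof. by case=> _ _ F0; apply/mem_set. Qed.

Lemma two_inductive1 (F : set (set nat)) :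
  omega_closed F -> two_inductive F -> up 1 \in F.
Proof. by move=> clF /(two_inductiveE clF) ->; apply/mem_set; right. Qed.

Definition F0 (F : set (set nat)) (hF : two_inductive F) : F :=
  exist (fun A => A \in F) (up 0) (two_inductive0 hF).

Definition F1 (F : set (set nat)) (clF : omega_closed F)
    (hF : two_inductive F) : F :=
  exist (fun A => A \in F) (up 1) (two_inductive1 clF hF).

(* [F0 hF] and [F1 clF hF] are the only members of [F], by [F01P]. *)
Definition alpha (F : set (set nat)) (clF : omega_closed F)
    (hF : two_inductive F) (k p : nat) (x : BZ clF) : BZ clF :=
  let: (i, j, A) := x in
  if A == F0 hF then (k%:Z * i, k%:Z * j, F0 hF)
  else (p%:Z + k%:Z * i, p%:Z + k%:Z * j, F1 clF hF).

Definition beta (F : set (set nat)) (clF : omega_closed F)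
    (hF : two_inductive F) (k p : nat) (x : BZ clF) : BZ clF :=
  let: (i, j, A) := x in
  if A == F0 hF then (k%:Z * i, k%:Z * j, F0 hF)
  else (p%:Z + k%:Z * i, p%:Z + k%:Z * j, F0 hF).

Lemma F01P (F : set (set nat)) (clF : omega_closed F) (hF : two_inductive F)
  (A : F) : A = F0 hF \/ A = F1 clF hF.
Proof.
have := set_mem (valP A); rewrite [X in X _](two_inductiveE clF hF).
by case=> E; [left | right]; apply/val_inj.
Qed.

Lemma F1_neq0 (F : set (set nat)) (clF : omega_closed F)
  (hF : two_inductive F) : F1 clF hF != F0 hF.
Proof. by apply/eqP => /(congr1 val) /up_inj. Qed.

Lemma alphaE (F : set (set nat)) (clF : omega_closed F)
    (hF : two_inductive F) (k p : nat) (i j : int) :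
  alpha hF k p ((i, j, F0 hF) : BZ clF) = (k%:Z * i, k%:Z * j, F0 hF) /\
  alpha hF k p ((i, j, F1 clF hF) : BZ clF) =
    (p%:Z + k%:Z * i, p%:Z + k%:Z * j, F1 clF hF).
Proof. by rewrite /alpha eqxx (negPf (F1_neq0 _ _)). Qed.

Lemma betaE (F : set (set nat)) (clF : omega_closed F)
    (hF : two_inductive F) (k p : nat) (i j : int) :
  beta hF k p ((i, j, F0 hF) : BZ clF) = (k%:Z * i, k%:Z * j, F0 hF) /\
  beta hF k p ((i, j, F1 clF hF) : BZ clF) =
    (p%:Z + k%:Z * i, p%:Z + k%:Z * j, F0 hF).
Proof. by rewrite /beta eqxx (negPf (F1_neq0 _ _)). Qed.

(* Main.v *)
Require Import Defs.
From mathcomp Require Import all_boot all_order all_algebra.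
From mathcomp Require Import boolp classical_sets functions cardinality.
From mathcomp Require Import zify.

(** Write (i, j, a) for the triple whose third coordinate is the set of the
    integers x >= a, where a is 0 or 1.  The idempotents are the (i, i, a);
    they form a chain in which (i, i, 0) is directly above (i, i, 1), which is
    directly above (i + 1, i + 1, 0).

    Every (i, j, 0) is the product of (i, 0, 0) and (0, j, 0).  Since
    (0, i, 0) (i, 0, 0) = (0, 0, 0) and the endomorphism fixes the right-hand
    side, the images of (i, 0, 0) and (0, i, 0) are forced to be (t, 0, 0) and
    (0, t, 0) for a single integer t ([image_inverse_pair]).  The relation
    (0, m, 0) (0, n, 0) = (0, m + n, 0), valid for m >= 0, makes t additive
    in i, hence t = k i for a fixed k; this k is positive because the
    endomorphism is injective and preserves the order of the idempotents
    ([image_up0]).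

    The elements (i, j, 1) are all obtained from one of them:
    (i, j, 1) = (i, 0, 0) (0, 0, 1) (0, j, 0).  The idempotent (0, 0, 1) is
    sent to some idempotent (p, p, d), and the product of the images is
    (p + k i, p + k j, d) ([image_up1]).  As (0, 0, 1) lies strictly between
    (0, 0, 0) and (1, 1, 0), its image lies strictly between (0, 0, 0) and
    (k, k, 0).  This means 0 <= p < k when d = 1, which is the case of [alpha],
    and 0 < p < k when d = 0, which is the case of [beta]. *)

Import Order.TTheory GRing.Theory Num.Theory.

Local Open Scope ring_scope.

Section InjectiveEndomorphisms.

Variables (F : set (set nat)) (clF : omega_closed F) (hF : two_inductive F).

Definition pt (a : bool) (i j : int) : BZ clF :=
  (i, j, if a then F1 clF hF else F0 hF).

Lemma ptP (x : BZ clF) : exists a i j, x = pt a i j.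
Proof.
case: x => [[i j] A].
by case: (F01P clF hF A) => ->; [exists false | exists true]; exists i, j.
Qed.

Lemma raw_pt a i j : raw (pt a i j) = (i, j, up a).
Proof. by case: a. Qed.

Lemma pt_inj a i j b k l : pt a i j = pt b k l -> [/\ a = b, i = k & j = l].
Proof.
move=> /(congr1 (@raw F clF)); rewrite !raw_pt => -[-> -> /up_inj].
by case: a b => [] [].
Qed.

(** Translating either member of the family down by a positive amount makes it
    contain all of the natural numbers, so when the inner coordinates differ
    only the factor with the larger one keeps its set. *)
Lemma mul_pt a i1 j1 b i2 j2 :
  (pt a i1 j1 * pt b i2 j2)%g =
  pt (if j1 < i2 then b else if i2 < j1 then a else a || b)
     (i1 + Num.max j1 i2 - j1) (j2 + Num.max j1 i2 - i2).
Proof.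
apply: raw_inj; rewrite raw_bz_mul !raw_pt raw_mulE.
congr (_, _, _); [lia | lia |].
apply/seteqP; split=> x; rewrite /up /=;
  by case: (ltgtP j1 i2); case: a b => [] [] /=; lia.
Qed.

Local Ltac calc_pt :=
  rewrite mul_pt; congr pt; solve [by case: ltgtP => //; lia | lia].

Variable e : {multiplicative BZ clF -> BZ clF}.
Hypothesis e_inj : injective e.
Hypothesis e_unit : e (pt false 0 0) = pt false 0 0.

Let eM x y z : (x * y)%g = z -> (e x * e y)%g = e z.
Proof. by move=> <-; rewrite gmulfM. Qed.

(** The identity (0, 0, 0) is neutral on the right of (i, 0, 0) and on the left
    of (0, i, 0), which makes the coordinates that must vanish nonnegative in
    the images; that (0, i, 0) (i, 0, 0) is the identity makes them
    nonpositive. *)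
Lemma image_inverse_pair i : exists t,
  e (pt false i 0) = pt false t 0 /\ e (pt false 0 i) = pt false 0 t.
Proof.
have [c [u [v Ex]]] := ptP (e (pt false i 0)).
have [d [w [z Ey]]] := ptP (e (pt false 0 i)).
have /eM : (pt false i 0 * pt false 0 0)%g = pt false i 0 by calc_pt.
have /eM : (pt false 0 0 * pt false 0 i)%g = pt false 0 i by calc_pt.
have /eM : (pt false 0 i * pt false i 0)%g = pt false 0 0 by calc_pt.
rewrite Ex Ey e_unit !mul_pt => /pt_inj[c1 i1 j1] /pt_inj[_ i2 _].
move=> /pt_inj[_ _ j3].
have ? : v = 0 by lia.
have ? : w = 0 by lia.
have ? : z = u by lia.
subst; exists u; move: c1; rewrite ltxx => /norP[/negPf -> /negPf ->].
by [].
Qed.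

Lemma image_up0 : exists k : nat, (0 < k)%N /\
  forall i j, e (pt false i j) = pt false (k%:Z * i) (k%:Z * j).
Proof.
have [f fE] := choice image_inverse_pair.
have eE i j : e (pt false i j) = pt false (f i) (f j).
  have /eM <- : (pt false i 0 * pt false 0 j)%g = pt false i j by calc_pt.
  by rewrite (fE i).1 (fE j).2; calc_pt.
have f0 : f 0 = 0 by have := e_unit; rewrite eE => /pt_inj[].
(* For i >= 0 the idempotent (i, i, 0) is below (0, 0, 0), hence so is its
   image (f i, f i, 0). *)
have f_ge0 i : 0 <= i -> 0 <= f i.
  move=> i0.
  have /eM : (pt false i i * pt false 0 0)%g = pt false i i by calc_pt.
  by rewrite !eE f0 mul_pt => /pt_inj[_ _]; lia.
have fD m n : 0 <= m -> f (m + n) = f m + f n.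
  move=> m0; have := f_ge0 m m0.
  have /eM : (pt false 0 m * pt false 0 n)%g = pt false 0 (m + n) by calc_pt.
  by rewrite !eE f0 mul_pt => /pt_inj[_ _]; lia.
have f_nat (n : nat) : f n%:Z = f 1 * n%:Z.
  elim: n => [|n IHn]; first by rewrite f0 mulr0.
  by rewrite -[n.+1]add1n PoszD fD // IHn mulrDr mulr1.
have f_int i : f i = f 1 * i.
  case: (lerP 0 i) => i0; first by rewrite -(gez0_abs i0) f_nat.
  have Ni_ge0 : 0 <= - i by lia.
  have := fD _ i Ni_ge0; rewrite addNr f0 -(gez0_abs Ni_ge0) f_nat gez0_abs //.
  by rewrite mulrN addrC => /esym/subr0_eq.
have f1_neq0 : f 1 <> 0.
  move=> f10; have /e_inj /pt_inj[] // : e (pt false 1 1) = e (pt false 0 0).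
  by rewrite !eE f0 f10.
have f1_ge0 := f_ge0 1 isT.
exists `|f 1|%N; split=> [|i j]; first by rewrite absz_gt0; apply/eqP.
by rewrite eE gez0_abs // -!f_int.
Qed.

(** The bounds on [p] express that the image of (0, 0, 1) is strictly between
    (0, 0, 0) and (k, k, 0).  If [d] is false then p = 0 would identify it with
    (0, 0, 0), against injectivity; if [d] is true, p = 0 is harmless. *)
Lemma image_up1 (k : nat) :
  (forall i j, e (pt false i j) = pt false (k%:Z * i) (k%:Z * j)) ->
  exists (d : bool) (p : nat), [/\ (p < k)%N, d || (0 < p)%N &
    forall i j, e (pt true i j) = pt d (p%:Z + k%:Z * i) (p%:Z + k%:Z * j)].
Proof.
move=> eE; have [d [p [q Eb]]] := ptP (e (pt true 0 0)).
have /eM : (pt true 0 0 * pt true 0 0)%g = pt true 0 0 by calc_pt.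
rewrite Eb mul_pt => /pt_inj[_ p1 q1].
have {p1 q1} ? : q = p by lia.
subst q.
have /eM : (pt false 0 0 * pt true 0 0)%g = pt true 0 0 by calc_pt.
rewrite e_unit Eb mul_pt => /pt_inj[_ _ p_ge0].
have {}p_ge0 : 0 <= p by lia.
(* The upper bound: (0, 0, 1) is above (1, 1, 0), which goes to (k, k, 0). *)
have /eM : (pt true 0 0 * pt false 1 1)%g = pt false 1 1 by calc_pt.
rewrite Eb !eE !mulr1 mul_pt => /pt_inj[d1 _ p_lek].
have p_neqk : p <> k%:Z.
  move=> pk; move: d1; rewrite pk ltxx orbF => d0.
  have /e_inj /pt_inj[] // : e (pt true 0 0) = e (pt false 1 1).
  by rewrite Eb eE d0 pk !mulr1.
exists d, `|p|%N; split=> [||i j]; first by lia.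
- case: d Eb {d1} => //= Eb; rewrite absz_gt0; apply/eqP => p0.
  have /e_inj /pt_inj[] // : e (pt true 0 0) = e (pt false 0 0).
  by rewrite Eb p0 e_unit.
- have E0j : e (pt true 0 j) = pt d p (p + k%:Z * j).
    have /eM <- : (pt true 0 0 * pt false 0 j)%g = pt true 0 j by calc_pt.
    rewrite Eb eE mulr0 mul_pt ltNge p_ge0 orbF if_same.
    by congr pt; lia.
  have /eM <- : (pt false i 0 * pt true 0 j)%g = pt true i j by calc_pt.
  rewrite eE E0j mulr0 mul_pt [p < 0]ltNge p_ge0 if_same gez0_abs //.
  by congr pt; lia.
Qed.

End InjectiveEndomorphisms.

Theorem theorem2p6 (F : set (set nat)) (clF : omega_closed F)
    (hF : two_inductive F) (e : {multiplicative BZ clF -> BZ clF}) :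
  injective e -> e (0, 0, F0 hF) = (0, 0, F0 hF) ->
  (exists k p : nat, [/\ (0 < k)%N, (p < k)%N & e =1 alpha hF k p]) \/
  (exists k p : nat,
     [/\ (2 <= k)%N, (0 < p < k)%N & e =1 beta hF k p]).
Proof.
move=> e_inj e_unit.
have [k [k_gt0 eE0]] := image_up0 _ _ _ e e_inj e_unit.
have [[] [p [p_ltk p_gt0 eE1]]] := image_up1 _ _ _ e e_inj e_unit k eE0.
- left; exists k, p; split=> // x.
  have [[] [i [j ->]]] := ptP _ _ hF x.
    by rewrite eE1 (alphaE clF hF k p i j).2.
  by rewrite eE0 (alphaE clF hF k p i j).1.
- right; exists k, p; split=> [||x]; [by lia | by apply/andP |].
  have [[] [i [j ->]]] := ptP _ _ hF x.
    by rewrite eE1 (betaE clF hF k p i j).2.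
  by rewrite eE0 (betaE clF hF k p i j).1.
Qed.
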